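(* Let $\log_G:G\to\mathfrak g$ be a log-Euclidean Lie group, let $H$ be a closed connected subgroup of $G$ (hence normal, since $G$ is abelian), and let $\pi:G\to G/H$ be the quotient map, viewed as a principal $H$-bundle for the action of $H$ on $G$ by right multiplication. Then the principal bundle $\pi:G\to G/H$ is trivial.
   Context: A log-Euclidean Lie group $\log_G:G\to\mathfrak g$ is a smooth manifold $G$ with a diffeomorphism $\log_G$ onto a finite-dimensional real vector space $\mathfrak g$ (identified with its Lie algebra), equipped with the commutative Lie group law $u\star v=\log_G^{-1}(\log_G(u)+\log_G(v))$. $G/H$ carries its standard quotient manifold and Lie group structure. A principal $H$-bundle is trivial if it is isomorphic, as a principal $H$-bundle over $G/H$, to the product bundle $G/H\times H$. *)

(* Defs.v *)
From HB Require Import structures.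
From mathcomp Require Import all_boot all_order all_algebra generic_quotient.
From mathcomp Require Import all_classical all_reals all_analysis.
Set Implicit Arguments.
Unset Strict Implicit.
Unset Printing Implicit Defensive.
Import Order.TTheory GRing.Theory Num.Theory.
Import numFieldNormedType.Exports.
Import VectorInternalTheory.
Local Open Scope classical_set_scope.
Local Open Scope ring_scope.

(** * Smooth manifolds

    Manifolds are modelled on a normed space [E], which is always ['rV[R]_n]
    or (for a product of two manifolds) ['rV[R]_m * 'rV[R]_n].  In finite
    dimension, [f] is C^(k+1) on an open set iff it is differentiable there
    and all maps [x |-> 'd f x v] are C^k.  The functions below are total;
    only their germs at the points of the open set [U] matter. *)

Fixpoint Cn_on (R : realType) (E F : normedModType R) (k : nat) (U : set E)
    (f : E -> F) : Prop :=
  match k with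
  | 0%N => forall x, U x -> {for x, continuous f}
  | k'.+1 => (forall x, U x -> differentiable f x) /\
             (forall v : E, Cn_on k' U (fun x => 'd f x v))
  end.

Definition smooth_on (R : realType) (E F : normedModType R) (U : set E)
    (f : E -> F) : Prop :=
  forall k, Cn_on k U f.

(** A chart is a homeomorphism between an open set of [M] and an open set of
    [E]; both directions are represented by total functions whose values
    outside these sets are irrelevant. *)
Record chart (R : realType) (M : topologicalType) (E : normedModType R) :=
  Chart {
    chart_dom : set M;
    chart_fun :> M -> E;
    chart_inv : E -> M;
    chart_dom_open : open chart_dom;
    chart_im_open : open (chart_fun @` chart_dom);
    chart_funK : forall x, chart_dom x -> chart_inv (chart_fun x) = x;
    chart_fun_continuous :
      forall x, chart_dom x -> {for x, continuous chart_fun};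
    chart_inv_continuous :
      forall y, (chart_fun @` chart_dom) y -> {for y, continuous chart_inv}
  }.

Definition smooth_atlas (R : realType) (M : topologicalType)
    (E : normedModType R) (A : set (chart M E)) : Prop :=
  (forall x : M, exists2 c, A c & chart_dom c x) /\
  (forall c d, A c -> A d ->
     smooth_on (c @` (chart_dom c `&` chart_dom d)) (d \o chart_inv c)).

(** The smooth structure is the one generated by the (not necessarily maximal)
    atlas [A]. *)
Definition smooth_manifold (R : realType) (M : topologicalType)
    (E : normedModType R) (A : set (chart M E)) : Prop :=
  [/\ hausdorff_space M, @second_countable M & smooth_atlas A].

Section SmoothMaps.
Context (R : realType) (M N : topologicalType) (E F : normedModType R).
Variables (A : set (chart M E)) (B : set (chart N F)).

Definition local_rep (c : chart M E) (d : chart N F) (f : M -> N) : E -> F :=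
  d \o f \o chart_inv c.

Definition smooth_map (f : M -> N) : Prop :=
  continuous f /\
  (forall c d, A c -> B d ->
     smooth_on (c @` (chart_dom c `&` f @^-1` chart_dom d)) (local_rep c d f)).

Definition immersion (f : M -> N) : Prop :=
  smooth_map f /\
  (forall c d x, A c -> B d -> chart_dom c x -> chart_dom d (f x) ->
     injective ('d (local_rep c d f) (c x))).

Definition submersion (f : M -> N) : Prop :=
  smooth_map f /\
  (forall c d x, A c -> B d -> chart_dom c x -> chart_dom d (f x) ->
     forall w : F, exists v : E, 'd (local_rep c d f) (c x) v = w).

End SmoothMaps.

Definition diffeomorphism (R : realType) (M N : topologicalType)
    (E F : normedModType R) (A : set (chart M E)) (B : set (chart N F))
    (f : M -> N) : Prop :=
  exists g : N -> M,
    [/\ cancel f g, cancel g f, smooth_map A B f & smooth_map B A g].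

Section ProductAtlas.
Context (R : realType) (M N : topologicalType) (E F : normedModType R).

Let prod_fun (c : chart M E) (d : chart N F) : M * N -> E * F :=
  fun p => (c p.1, d p.2).
Let prod_inv (c : chart M E) (d : chart N F) : E * F -> M * N :=
  fun q => (chart_inv c q.1, chart_inv d q.2).

Let openX (S T : topologicalType) (U : set S) (V : set T) :
  open U -> open V -> open (U `*` V).
Proof.
move=> oU oV; rewrite openE => -[x y] [/= Ux Vy].
by exists (U, V) => //; split; exact: open_nbhs_nbhs.
Qed.

Let prod_im (c : chart M E) (d : chart N F) :
  prod_fun c d @` (chart_dom c `*` chart_dom d) =
  (c @` chart_dom c) `*` (d @` chart_dom d).
Proof.
apply/seteqP; split=> [_ [[x y] [/= cx dy] <-]|].
  by split => /=; [exists x | exists y].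
by move=> [_ _] [/= [x cx <-] [y dy <-]]; exists (x, y).
Qed.

Let cvg_prod (S T S' T' : topologicalType) (f : S -> S') (g : T -> T') p :
  {for p.1, continuous f} -> {for p.2, continuous g} ->
  {for p, continuous (fun q : S * T => (f q.1, g q.2))}.
Proof.
move=> fp gp; apply: cvg_pair => /=.
- by apply: (cvg_comp _ _ cvg_fst); exact: fp.
- by apply: (cvg_comp _ _ cvg_snd); exact: gp.
Qed.

Program Definition prod_chart (c : chart M E) (d : chart N F) :
    chart (M * N)%type (E * F)%type :=
  @Chart R (M * N)%type (E * F)%type (chart_dom c `*` chart_dom d)
    (prod_fun c d) (prod_inv c d) _ _ _ _ _.
Next Obligation. by move=> c d; apply: openX; exact: chart_dom_open. Qed.
Next Obligation.
by move=> c d; rewrite prod_im; apply: openX; exact: chart_im_open.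
Qed.
Next Obligation.
by move=> c d [x y] [/= cx dy]; rewrite /prod_inv /= !chart_funK.
Qed.
Next Obligation.
by move=> c d [x y] [/= cx dy]; apply: cvg_prod; exact: chart_fun_continuous.
Qed.
Next Obligation.
move=> c d q; rewrite prod_im => -[q1 q2].
by apply: cvg_prod; exact: chart_inv_continuous.
Qed.

Definition prod_atlas (A : set (chart M E)) (B : set (chart N F)) :
    set (chart (M * N)%type (E * F)%type) :=
  [set e | exists c d, [/\ A c, B d & e = prod_chart c d]].

End ProductAtlas.

(** The standard topology and smooth structure of a finite-dimensional real
    vector space [g], given by the linear coordinates
    [v2r : g -> 'rV[R]_(dim g)]. *)
Section VectorSpace.
Context (R : realType) (g : vectType R).

Definition vect_top : topologicalType :=
  @initial_topology g 'rV[R]_(dim g) v2r.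

Program Definition vect_chart : chart vect_top 'rV[R]_(dim g) :=
  @Chart R vect_top 'rV[R]_(dim g) setT (v2r : g -> 'rV[R]_(dim g))
    (r2v : 'rV[R]_(dim g) -> g) _ _ _ _ _.
Next Obligation. exact: openT. Qed.
Next Obligation.
rewrite (_ : _ @` _ = setT); first exact: openT.
by apply/seteqP; split=> // y _; exists (r2v y) => //; rewrite r2vK.
Qed.
Next Obligation. by move=> x _ /=; rewrite v2rK. Qed.
Next Obligation. by move=> x _; exact: initial_continuous. Qed.
Next Obligation.
move=> y _; suff h : continuous (r2v : 'rV[R]_(dim g) -> vect_top) by exact: h.
apply/continuousP => _ [U oU <-].
by rewrite (_ : _ @^-1` _ = U)//; apply/seteqP; split=> z /=; rewrite r2vK.
Qed.

Definition vect_atlas : set (chart vect_top 'rV[R]_(dim g)) := [set vect_chart].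

End VectorSpace.

(** * Abelian groups, subgroups and quotients *)

Record abelian_law (T : Type) := AbelianLaw {
  lmul : T -> T -> T;
  lone : T;
  linv : T -> T;
  lmulA : associative lmul;
  lmulC : commutative lmul;
  lmul1 : left_id lone lmul;
  lmulV : left_inverse lone linv lmul
}.

Record subgroup (T : Type) (l : abelian_law T) := Subgroup {
  sub_set :> set T;
  sub_one : sub_set (lone l);
  sub_mul : forall x y, sub_set x -> sub_set y -> sub_set (lmul l x y);
  sub_inv : forall x, sub_set x -> sub_set (linv l x)
}.

(** For [S : set T], the type [set_type S] is the subtype of its elements;
    when [T] is a topological space it carries the subspace topology. *)
Section SubgroupLaw.
Context (T : Type) (l : abelian_law T) (H : subgroup l).
Local Notation HT := (set_type H).

Definition subl_mul (x y : HT) : HT :=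
  SigSub (mem_set (sub_mul (set_valP x) (set_valP y))).
Definition subl_one : HT := SigSub (mem_set (sub_one H)).
Definition subl_inv (x : HT) : HT := SigSub (mem_set (sub_inv (set_valP x))).

Program Definition sub_law : abelian_law HT :=
  @AbelianLaw HT subl_mul subl_one subl_inv _ _ _ _.
Next Obligation. by move=> x y z; apply: val_inj; rewrite /= lmulA. Qed.
Next Obligation. by move=> x y; apply: val_inj; rewrite /= lmulC. Qed.
Next Obligation. by move=> x; apply: val_inj; rewrite /= lmul1. Qed.
Next Obligation. by move=> x; apply: val_inj; rewrite /= lmulV. Qed.

End SubgroupLaw.

Section QuotientGroup.
Context (T : topologicalType) (l : abelian_law T) (H : subgroup l).
Local Open Scope quotient_scope.

Definition coset_rel (x y : T) : bool := `[< sub_set H (lmul l (linv l x) y) >].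

Let inv_unique x y : lmul l x y = lone l -> linv l x = y.
Proof.
move=> xy; rewrite -[LHS](lmul1 l) lmulC -xy.
by rewrite lmulA lmulV lmul1.
Qed.

Let invK x : linv l (linv l x) = x.
Proof. by apply: inv_unique; rewrite lmulV. Qed.

Let invM x y : linv l (lmul l x y) = lmul l (linv l x) (linv l y).
Proof.
apply: inv_unique; rewrite (lmulC l x) -lmulA (lmulA l x).
by rewrite (lmulC l x (linv l x)) lmulV lmul1 lmulC lmulV.
Qed.

Let coset_refl : reflexive coset_rel.
Proof. by move=> x; apply/asboolP; rewrite lmulV; exact: sub_one. Qed.

Let coset_sym : symmetric coset_rel.
Proof.
suff h x y : coset_rel x y -> coset_rel y x by move=> x y; apply/idP/idP => /h.
move=> /asboolP xy; apply/asboolP.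
by have := sub_inv xy; rewrite invM invK lmulC.
Qed.

Let coset_trans : transitive coset_rel.
Proof.
move=> y x z /asboolP xy /asboolP yz; apply/asboolP.
have := sub_mul xy yz.
by rewrite -lmulA [lmul l y _]lmulA [lmul l y _]lmulC lmulV lmul1.
Qed.

Definition coset_equiv : equiv_rel T :=
  EquivRel coset_rel coset_refl coset_sym coset_trans.

(** [G/H] with the quotient topology. *)
Definition quot_top : topologicalType :=
  quotient_topology {eq_quot coset_equiv}.

Definition quot_pi (x : T) : quot_top := \pi_quot_top x.

Lemma quot_piP x y : quot_pi x = quot_pi y <-> sub_set H (lmul l (linv l x) y).
Proof.
split=> [/eqmodP/asboolP//|h]; exact/eqmodP/asboolP.
Qed.

Definition quotl_mul (a b : quot_top) : quot_top :=
  quot_pi (lmul l (repr a) (repr b)).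
Definition quotl_one : quot_top := quot_pi (lone l).
Definition quotl_inv (a : quot_top) : quot_top := quot_pi (linv l (repr a)).

Let reprE x : sub_set H (lmul l (linv l (repr (quot_pi x))) x).
Proof. by apply/quot_piP; rewrite /quot_pi reprK. Qed.

Lemma quotl_mulE x y : quotl_mul (quot_pi x) (quot_pi y) = quot_pi (lmul l x y).
Proof.
apply/quot_piP; rewrite invM.
have := sub_mul (reprE x) (reprE y).
congr (sub_set H _); rewrite -!lmulA; congr (lmul l _ _).
by rewrite !lmulA [lmul l x _]lmulC.
Qed.

Lemma quotl_invE x : quotl_inv (quot_pi x) = quot_pi (linv l x).
Proof.
by apply/quot_piP; rewrite -invM; exact: sub_inv (reprE x).
Qed.

Let quotW (P : quot_top -> Prop) : (forall x, P (quot_pi x)) -> forall a, P a.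
Proof. by move=> h a; have := h (repr a); rewrite /quot_pi reprK. Qed.

Program Definition quot_law : abelian_law quot_top :=
  @AbelianLaw quot_top quotl_mul quotl_one quotl_inv _ _ _ _.
Next Obligation.
elim/quotW => x; elim/quotW => y; elim/quotW => z.
by rewrite !quotl_mulE lmulA.
Qed.
Next Obligation.
by elim/quotW => x; elim/quotW => y; rewrite !quotl_mulE lmulC.
Qed.
Next Obligation. by elim/quotW => x; rewrite /quotl_one quotl_mulE lmul1. Qed.
Next Obligation.
by elim/quotW => x; rewrite quotl_invE quotl_mulE lmulV.
Qed.

End QuotientGroup.

(** * Lie groups *)

Definition lie_group (R : realType) (T : topologicalType) (E : normedModType R)
    (A : set (chart T E)) (l : abelian_law T) : Prop :=
  [/\ smooth_manifold A,
      smooth_map (prod_atlas A A) A (fun p : T * T => lmul l p.1 p.2)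
    & smooth_map A A (linv l)].

Record log_euclidean (R : realType) (g : vectType R) := LogEuclidean {
  le_dim : nat;
  le_space :> topologicalType;
  le_atlas : set (chart le_space 'rV[R]_le_dim);
  le_manifold : smooth_manifold le_atlas;
  le_log : le_space -> g;
  le_exp : g -> le_space;
  le_logK : cancel le_log le_exp;
  le_expK : cancel le_exp le_log;
  le_log_smooth :
    smooth_map le_atlas (@vect_atlas R g) (le_log : le_space -> vect_top g);
  le_exp_smooth :
    smooth_map (@vect_atlas R g) le_atlas (le_exp : vect_top g -> le_space)
}.

Arguments le_atlas {R g} G _ : rename.
Arguments le_log {R g} G _ : rename.
Arguments le_exp {R g} G _ : rename.

Program Definition le_law (R : realType) (g : vectType R)
    (G : log_euclidean g) : abelian_law G :=
  @AbelianLaw G (fun u v => le_exp G (le_log G u + le_log G v))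
    (le_exp G 0) (fun u => le_exp G (- le_log G u)) _ _ _ _.
Next Obligation. by move=> R g G x y z; rewrite !le_expK addrA. Qed.
Next Obligation. by move=> R g G x y; rewrite addrC. Qed.
Next Obligation. by move=> R g G x; rewrite le_expK add0r le_logK. Qed.
Next Obligation. by move=> R g G x; rewrite le_expK addNr. Qed.

(** The Lie group structure of a closed subgroup: the one for which [H], with
    the subspace topology, is an embedded submanifold.  As [set_type H] carries
    the subspace topology, the inclusion is a topological embedding, so it is a
    smooth embedding iff it is an immersion. *)
Definition embedded_lie_subgroup (R : realType) (T : topologicalType)
    (E F : normedModType R) (A : set (chart T E)) (l : abelian_law T)
    (H : subgroup l) (AH : set (chart (set_type H) F)) : Prop :=
  lie_group AH (sub_law H) /\ immersion AH A (set_val : set_type H -> T).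

(** The standard Lie group structure of [G/H]: the one for which the quotient
    map is a smooth submersion. *)
Definition quotient_lie_group (R : realType) (T : topologicalType)
    (E F : normedModType R) (A : set (chart T E)) (l : abelian_law T)
    (H : subgroup l) (AQ : set (chart (quot_top H) F)) : Prop :=
  lie_group AQ (quot_law H) /\ submersion A AQ (quot_pi H).

(** * Principal bundles *)

(** Isomorphism, over the base [B], of principal bundles with structure group
    [S], the right actions being [act] and [act']. *)
Definition principal_bundle_iso (R : realType) (P P' : topologicalType)
    (B S : Type) (E E' : normedModType R)
    (AP : set (chart P E)) (p : P -> B) (act : P -> S -> P)
    (AP' : set (chart P' E')) (p' : P' -> B) (act' : P' -> S -> P')
    (f : P -> P') : Prop :=
  [/\ diffeomorphism AP AP' f,
      forall x, p' (f x) = p x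
    & forall x s, f (act x s) = act' (f x) s].

Definition trivial_principal_bundle (R : realType) (P B S : topologicalType)
    (E F K : normedModType R) (AP : set (chart P E)) (AB : set (chart B F))
    (AS : set (chart S K)) (l : abelian_law S) (p : P -> B)
    (act : P -> S -> P) : Prop :=
  exists f : P -> B * S,
    principal_bundle_iso AP p act
      (prod_atlas AB AS) fst (fun y s => (y.1, lmul l y.2 s)) f.

Definition right_mul (T : Type) (l : abelian_law T) (H : subgroup l) (x : T)
    (h : set_type H) : T :=
  lmul l x (set_val h).

(* Main.v *)
(** In logarithmic coordinates [G] is [R^N] and [H] is a closed connected
    additive subgroup [W].  Let [L] be the image of the differential of the
    inclusion of [H] at the identity; by translation it is the same at every
    point.  If [c] is a curve in [W] with [c(0) = 0], then
    [n c(1/n) -> c'(0)], so [L] is contained in the closed set [W].  Conversely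
    the inclusion modulo [L] has zero differential, hence is constant on the
    connected [H], so [W = L] is a linear subspace.  With [P] a linear
    projection onto [W], the map [x |-> (x H, exp (P (log x)))] is the
    trivialisation; its inverse sends [(x H, h)] to
    [exp ((1 - P) (log x)) * h].  Smoothness of [exp \o P] into [H], and of the
    section [x H |-> exp ((1 - P) (log x))], does not need the inverse function
    theorem: both are already known to be continuous, and a continuous solution
    [g] of [phi \o g = b] with [phi], [b] smooth and ['d phi] invertible is
    smooth. *)
Require Import Defs.
From HB Require Import structures.
From mathcomp Require Import all_boot all_order all_algebra.
From mathcomp Require Import all_classical all_reals all_analysis.
From mathcomp Require Import lra.
Set Implicit Arguments.
Unset Strict Implicit.
Unset Printing Implicit Defensive.
Import Order.TTheory GRing.Theory Num.Theory.
Import numFieldNormedType.Exports.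
Import VectorInternalTheory.
Local Open Scope classical_set_scope.
Local Open Scope ring_scope.

(** * Functions of class C^k *)

Section Differential.
Context {R : realType} {E F : normedModType R}.

(** The estimate is the expansion of [f] at [x] up to o(h), and differentials are unique, so [df]
    must be ['d f x]. *)
Lemma is_diff_eps (f : E -> F) (df : {linear E -> F}) x :
  continuous df ->
  (forall e, 0 < e ->
    \forall h \near (0 : E), `|f (h + x) - f x - df h| <= e * `|h|) ->
  is_diff x f df.
Proof.
move=> dfc H.
have H' : f \o shift x = cst (f x) + df +o_ 0 id.
  apply/eqaddoP => e /H; apply: filterS => h.
  by rewrite /= opprD addrA.
have H2 := diff_unique dfc H'.
split=> //; apply/diff_locallyP; rewrite H2; split=> //.
Qed.

Lemma differentiable_eps (f : E -> F) x :
  differentiable f x -> forall e, 0 < e ->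
    \forall h \near (0 : E), `|f (h + x) - f x - 'd f x h| <= e * `|h|.
Proof.
move=> /diff_locally /eqaddoP H e /H; apply: filterS => h /=.
by rewrite opprD addrA.
Qed.

Lemma is_diff_near (f g : E -> F) (df : E -> F) x :
  (\forall y \near x, f y = g y) -> is_diff x f df -> is_diff x g df.
Proof.
move=> fg dfx.
have fgx : f x = g x by exact: nbhs_singleton fg.
(* [df] is a bare function, whereas [is_diff_eps] asks for a linear map, so it is traded for the
   equal ['d f x]. *)
suff : is_diff x g ('d f x) by rewrite diff_val.
apply: is_diff_eps => [|e e0]; first exact:
  (diff_continuous (ex_diff : differentiable f x)).
have H := differentiable_eps (ex_diff : differentiable f x) e0.
have fg' : \forall h \near (0 : E), f (h + x) = g (h + x).
  have c : (h + x) @[h --> (0 : E)] --> x.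
    by rewrite -[X in _ --> X]add0r; apply: cvgD; [exact: cvg_id|exact: cvg_cst].
  exact: (c _ fg).
near=> h.
rewrite -fgx -(near fg' h)//.
near: h; exact: H.
Unshelve. all: by end_near. Qed.


(** Product rule: the chain rule for the pair of [f] and [g] followed by the continuous bilinear map
    [a, u |-> a *: u]. *)
Lemma is_diff_scale (f : E -> R) (g : E -> F) df dg x :
  is_diff x f df -> is_diff x g dg ->
  is_diff x (fun y => f y *: g y) (fun v => df v *: g x + f x *: dg v).
Proof.
move=> fx gx.
have scb : bilinear_for
    (GRing.Scale.Law.clone _ _ *:%R _) (GRing.Scale.Law.clone _ _ *:%R _)
    (fun (a : R) (u : F) => a *: u).
  split=> [u a b c|a b c d]/=; first by rewrite scalerDl scalerA.
  by rewrite scalerDr !scalerA mulrC.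
pose scl : {bilinear R -> F -> F} := HB.pack (fun (a : R) (u : F) => a *: u)
  (bilinear_isBilinear.Build R R F F _ _ _ scb).
have sc : continuous (fun p : R * F => scl p.1 p.2).
  by move=> p; exact: scale_continuous.
have D : is_diff (f x, g x) (fun p : R * F => p.1 *: p.2)
    (fun q => f x *: q.2 + q.1 *: g x).
  by split; [exact: differentiable_bilin sc|exact: diff_bilin sc].
have H := is_diff_comp (is_diff_pair fx gx) D.
by apply: is_diff_eq H _; apply/funext => v /=; rewrite addrC.
Qed.
End Differential.

(** * Closure properties of C^k maps, up to the chain rule *)

Section CnOn.
Context {R : realType}.
Implicit Types E F K : normedModType R.

Lemma Cn_on_sub E F k (U V : set E) (f : E -> F) :
  U `<=` V -> Cn_on k V f -> Cn_on k U f.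
Proof.
move=> UV; elim: k f => [f fV x /UV /fV //|k IH f /= [fV dfV]].
by split=> [x /UV /fV //|v]; exact: IH.
Qed.

Lemma eq_Cn_on E F k (U : set E) (f g : E -> F) : open U ->
  (forall x, U x -> f x = g x) -> Cn_on k U f -> Cn_on k U g.
Proof.
move=> oU; elim: k f g => [f g fg fV x Ux|k IH f g fg /= [fV dfV]].
  have fgx : \forall y \near x, f y = g y.
    by near=> y; apply: fg; near: y; exact: open_nbhs_nbhs.
  have fx : f @ x --> f x by exact: fV.
  rewrite (fg x Ux) in fx; apply: cvg_trans fx.
  by apply: near_eq_cvg; apply: filterS fgx.
have d x : U x -> is_diff x g ('d f x).
  move=> Ux; apply: is_diff_near (differentiableP (fV x Ux)).
  by near=> y; apply: fg; near: y; exact: open_nbhs_nbhs.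
split=> [x /d dx|v]; first exact: ex_diff.
apply: IH (dfV v) => x /d dx.
by rewrite (@diff_val _ _ _ _ _ _ _ dx).
Unshelve. all: by end_near. Qed.

(** Being C^k on an open set depends only on the values there, so a formula for the differential
    valid on [U] can replace ['d f]. This is the inductive step of most closure properties below. *)
Lemma Cn_onS E F k (U : set E) (f : E -> F) (df : E -> E -> F) : open U ->
  (forall x, U x -> is_diff x f (df x)) ->
  (forall v, Cn_on k U (df ^~ v)) -> Cn_on k.+1 U f.
Proof.
move=> oU d c; split=> [x /d dx|v]; first exact: ex_diff.
apply: eq_Cn_on oU _ (c v) => x /d dx.
by rewrite (@diff_val _ _ _ _ _ _ _ dx).
Qed.

Lemma Cn_onS_diff E F k (U : set E) (f : E -> F) x :
  Cn_on k.+1 U f -> U x -> is_diff x f ('d f x).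
Proof. by move=> [d _] Ux; exact/differentiableP/d. Qed.

Lemma Cn_on_diff E F k (U : set E) (f : E -> F) v :
  Cn_on k.+1 U f -> Cn_on k U (fun x => 'd f x v).
Proof. by case=> _; exact. Qed.

Lemma Cn_on_pred E F k (U : set E) (f : E -> F) :
  Cn_on k.+1 U f -> Cn_on k U f.
Proof.
elim: k f => [f [d _] x Ux|k IH f /= [d c]].
  exact/differentiable_continuous/d.
by split=> // v; exact: IH.
Qed.

Lemma Cn_on_cst E F k (U : set E) (a : F) : open U -> Cn_on k U (fun=> a).
Proof.
move=> oU; elim: k a => [a x _|k IH a]; first exact: cst_continuous.
apply: (@Cn_onS _ _ _ _ _ (fun _ _ => 0)) => // x _.
Qed.

Lemma Cn_on_lin E F k (U : set E) (f : {linear E -> F}) : open U ->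
  continuous f -> Cn_on k U f.
Proof.
move=> oU fc; case: k => [x _|k]; first exact: fc.
apply: (@Cn_onS _ _ _ _ _ (fun _ => f)) => // [x _|v]; last exact: Cn_on_cst.
by split; [exact: linear_differentiable|exact: diff_lin].
Qed.

Lemma Cn_onD E F k (U : set E) (f g : E -> F) : open U ->
  Cn_on k U f -> Cn_on k U g -> Cn_on k U (fun x => f x + g x).
Proof.
move=> oU; elim: k f g => [f g cf cg x Ux|k IH f g cf cg].
  by apply: cvgD; [exact: cf|exact: cg].
apply: (@Cn_onS _ _ _ _ _ (fun x v => 'd f x v + 'd g x v)) => // [x Ux|v].
  by have := is_diffD (Cn_onS_diff cf Ux) (Cn_onS_diff cg Ux).
by apply: IH; exact: Cn_on_diff.
Qed.

Lemma Cn_on_sum E F k (U : set E) (I : Type) (r : seq I) (f : I -> E -> F) :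
  open U -> (forall i, Cn_on k U (f i)) ->
  Cn_on k U (fun x => \sum_(i <- r) f i x).
Proof.
move=> oU cf; elim: r => [|i r IH].
  by under eq_fun do rewrite big_nil; exact: Cn_on_cst.
by under eq_fun do rewrite big_cons; exact: Cn_onD.
Qed.

Lemma Cn_onZ E F k (U : set E) (f : E -> R) (g : E -> F) : open U ->
  Cn_on k U f -> Cn_on k U g -> Cn_on k U (fun x => f x *: g x).
Proof.
move=> oU; elim: k f g => [f g cf cg x Ux|k IH f g cf cg].
  by apply: cvgZ; [exact: cf|exact: cg].
apply: (@Cn_onS _ _ _ _ _ (fun x v => 'd f x v *: g x + f x *: 'd g x v)) => //
    [x Ux|v].
  exact: is_diff_scale (Cn_onS_diff cf Ux) (Cn_onS_diff cg Ux).
apply: Cn_onD => //; apply: IH => //; try exact: Cn_on_pred.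
- exact: Cn_on_diff.
- exact: Cn_on_diff.
Qed.

Lemma Cn_on_prod E k (U : set E) (I : Type) (r : seq I) (f : I -> E -> R) :
  open U -> (forall i, Cn_on k U (f i)) ->
  Cn_on k U (fun x => \prod_(i <- r) f i x).
Proof.
move=> oU cf; elim: r => [|i r IH].
  by under eq_fun do rewrite big_nil; exact: Cn_on_cst.
by under eq_fun do rewrite big_cons; exact: (@Cn_onZ _ R).
Qed.

Lemma Cn_onV E k (U : set E) (f : E -> R) : open U ->
  (forall x, U x -> f x != 0) ->
  Cn_on k U f -> Cn_on k U (fun x => (f x)^-1).
Proof.
move=> oU f0; elim: k => [cf x Ux|k IH cf].
  by apply: cvgV; [exact: f0|exact: cf].
(* The derivative of 1/f contains 1/f again, so the induction hypothesis is used for the very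
   function being treated. *)
have cfV := IH (Cn_on_pred cf).
apply: (@Cn_onS _ _ _ _ _
    (fun x v => ((-1 * (f x)^-1) * (f x)^-1) * 'd f x v)) => // [x Ux|v].
  split; first by apply: differentiableV; [case: cf => + _; exact|exact: f0].
  rewrite diffV; [|by case: cf => + _; exact|exact: f0].
  by apply/funext => v /=; rewrite mulN1r mulNr -exprVn expr2.
apply: (@Cn_onZ _ R) => //; last exact: Cn_on_diff.
apply: (@Cn_onZ _ R) => //.
by apply: (@Cn_onZ _ R) => //; exact: Cn_on_cst.
Qed.

Lemma Cn_on_pair E F K k (U : set E) (f : E -> F) (g : E -> K) : open U ->
  Cn_on k U f -> Cn_on k U g -> Cn_on k U (fun x => (f x, g x)).
Proof.
move=> oU; elim: k f g => [f g cf cg x Ux|k IH f g cf cg].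
  by apply: cvg_pair; [exact: cf|exact: cg].
apply: (@Cn_onS _ _ _ _ _ (fun x v => ('d f x v, 'd g x v))) => // [x Ux|v].
  exact: is_diff_pair (Cn_onS_diff cf Ux) (Cn_onS_diff cg Ux).
by apply: IH; exact: Cn_on_diff.
Qed.

(** A finite basis [e] with smooth coordinates [l]: since [Cn_on] only gives
    the regularity of [x |-> 'd f x v] for fixed [v], the chain rule has to
    expand ['d f (g x) ('d g x v)] along such a basis. *)
Definition smooth_coord F := exists n (e : 'I_n -> F) (l : 'I_n -> F -> R),
  (forall i E k (U : set E) g, open U -> Cn_on k U g -> Cn_on k U (l i \o g)) /\
  (forall x, x = \sum_i l i x *: e i).

(** The derivative of [f \o g] along [v] is [f] applied to ['d g x v], a composite of the same
    shape, so the induction closes without coordinates on [F]. *)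
Lemma Cn_on_lin_comp E F K k (U : set E) (f : {linear F -> K}) (g : E -> F) :
  open U -> continuous f -> Cn_on k U g -> Cn_on k U (f \o g).
Proof.
move=> oU fc; elim: k g => [g cg x Ux|k IH g cg].
  by apply: continuous_comp; [exact: cg|exact: fc].
apply: (@Cn_onS _ _ _ _ _ (fun x => f \o 'd g x)) => // [x Ux|v].
  apply: is_diff_comp (Cn_onS_diff cg Ux) _.
  by split; [exact: linear_differentiable|exact: diff_lin].
by apply: (IH (fun x => 'd g x v)); exact: Cn_on_diff.
Qed.

Lemma Cn_on_comp E F K k (U : set E) (V : set F) (g : E -> F) (f : F -> K) :
  smooth_coord F -> open U -> (forall x, U x -> V (g x)) ->
  Cn_on k V f -> Cn_on k U g -> Cn_on k U (f \o g).
Proof.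
move=> [n [e [l [lC lE]]]] oU UV; elim: k f => [f cf cg x Ux|k IH f cf cg].
  by apply: continuous_comp; [exact: cg|apply: cf; exact: UV].
apply: (@Cn_onS _ _ _ _ _
  (fun x v => \sum_i l i ('d g x v) *: 'd f (g x) (e i))) => // [x Ux|v].
  apply: is_diff_eq; first exact:
    is_diff_comp (Cn_onS_diff cg Ux) (Cn_onS_diff cf (UV _ Ux)).
  apply/funext => v /=; rewrite [in LHS](lE ('d g x v)) linear_sum.
  by apply: eq_bigr => i _; rewrite linearZ.
apply: Cn_on_sum => // i; apply: Cn_onZ => //.
  by apply: (lC i _ _ _ (fun x => 'd g x v)) => //; exact: Cn_on_diff.
by apply: (IH (fun y => 'd f y (e i))); [exact: Cn_on_diff|exact: Cn_on_pred].
Qed.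

Lemma Cn_on_coord E k (U : set E) m n (f : E -> 'M[R]_(m, n)) i j :
  open U -> Cn_on k U f -> Cn_on k U (fun x => f x i j).
Proof.
move=> oU cf.
have @l : {linear 'M[R]_(m, n) -> R}.
  by exists (fun N : 'M[R]_(m, n) => N i j); do 2![eexists]; do ?[constructor];
     rewrite ?mxE// => ? *; rewrite ?mxE//; move=> ?; rewrite !mxE.
by apply: (@Cn_on_lin_comp _ _ _ _ _ l) => //; exact: coord_continuous.
Qed.

Lemma Cn_on_rV E k (U : set E) n (f : E -> 'rV[R]_n) : open U ->
  (forall j, Cn_on k U (fun x => f x 0 j)) -> Cn_on k U f.
Proof.
move=> oU cf; have -> : f = fun x => \sum_j f x 0 j *: delta_mx 0 j.
  by apply/funext => x; exact: row_sum_delta.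
by apply: Cn_on_sum => // j; apply: Cn_onZ => //; exact: Cn_on_cst.
Qed.

Lemma Cn_on_det E k (U : set E) n (A : E -> 'M[R]_n) : open U ->
  (forall i j, Cn_on k U (fun x => A x i j)) -> Cn_on k U (fun x => \det (A x)).
Proof.
move=> oU cA; apply: Cn_on_sum => // s; apply: (@Cn_onZ _ R) => //.
  exact: Cn_on_cst.
by apply: Cn_on_prod => // i; exact: cA.
Qed.

(** Cramer's rule: each entry of the inverse is a cofactor, polynomial in the entries of [A x],
    divided by a nonvanishing determinant. *)
Lemma Cn_on_invmx E k (U : set E) n (A : E -> 'M[R]_n) i j : open U ->
  (forall x, U x -> A x \in unitmx) ->
  (forall i j, Cn_on k U (fun x => A x i j)) ->
  Cn_on k U (fun x => invmx (A x) i j).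
Proof.
move=> oU uA cA.
apply: (@eq_Cn_on _ _ _ _ (fun x => (\det (A x))^-1 *
   ((-1) ^+ (j + i) * \det (row' j (col' i (A x)))))) => //.
  by move=> x /uA u; rewrite /invmx u !mxE.
apply: (@Cn_onZ _ R) => //.
  apply: Cn_onV => // [x /uA|]; last exact: Cn_on_det.
  by rewrite unitmxE unitfE.
apply: (@Cn_onZ _ R) => //; first exact: Cn_on_cst.
apply: Cn_on_det => // a b; under eq_fun do rewrite !mxE.
exact: cA.
Qed.

Lemma smooth_coord_rV n : smooth_coord 'rV[R]_n.
Proof.
exists n, (fun i => delta_mx 0 i), (fun i (x : 'rV[R]_n) => x 0 i); split.
  move=> i E k U g oU cg.
  exact: Cn_on_coord.
exact: row_sum_delta.
Qed.

Lemma smooth_coord_prod E F : smooth_coord E -> smooth_coord F ->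
  smooth_coord (E * F)%type.
Proof.
move=> [n [e [l [lC lE]]]] [n' [e' [l' [lC' lE']]]].
pose ee i :=
  match fintype.split i with inl i => (e i, 0) | inr i => (0, e' i) end.
pose ll i :=
  match fintype.split i with inl i => l i \o fst | inr i => l' i \o snd end.
exists (n + n')%N, ee, ll; split=> [i G k U g oU cg|[x y]].
  rewrite /ll; case: fintype.split => j.
  - apply: (lC j _ _ _ (fun x => (g x).1)) => //.
    apply: (@Cn_on_lin_comp _ _ _ _ _ fst) => // p; exact: cvg_fst.
  - apply: (lC' j _ _ _ (fun x => (g x).2)) => //.
    apply: (@Cn_on_lin_comp _ _ _ _ _ snd) => // p; exact: cvg_snd.
rewrite big_split_ord /=.
under eq_bigr => i _ do rewrite /ll /ee (unsplitK (inl i)) /=.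
under [X in _ = _ + X]eq_bigr => i _ do rewrite /ll /ee (unsplitK (inr i)) /=.
rewrite {1}(lE x) {1}(lE' y).
apply: injective_projections.
  rewrite [RHS](linearD fst) !linear_sum /= [X in _ = _ + X]big1 ?addr0//.
  by move=> i _; rewrite scaler0.
rewrite [RHS](linearD snd) !linear_sum /= [X in _ = X + _]big1 ?add0r//.
by move=> i _; rewrite scaler0.
Qed.
End CnOn.

(** * Smoothness of implicitly defined maps, and maps constant along a segment *)

Section Inverse.
Context {R : realType}.
Implicit Types E F : normedModType R.

Lemma mulmxr_continuous m n (A : 'M[R]_(m, n)) :
  continuous (fun x : 'rV[R]_m => x *m A).
Proof.
(* Continuity is the case k = 0 of a statement that can be checked entry by entry. *)
suff H k : Cn_on k setT (fun x : 'rV[R]_m => x *m A).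
  by move=> x; exact: (H 0%N).
apply: Cn_on_rV => [|j]; first exact: openT.
under eq_fun do rewrite mxE.
apply: (@Cn_on_sum _ _ R) => [|i]; first exact: openT.
apply: (@Cn_onZ _ _ R); [exact: openT| |exact/Cn_on_cst/openT].
apply: Cn_on_coord; first exact: openT.
by apply: (@Cn_on_lin _ _ _ _ _ idfun); [exact: openT|move=> x].
Qed.

Lemma is_diff_mulmxr E m n (A : 'M[R]_(m, n)) (f df : E -> 'rV[R]_m) x :
  is_diff x f df -> is_diff x (fun y => f y *m A) (fun v => df v *m A).
Proof.
move=> dfx.
suff h : is_diff (f x) (mulmxr A) (mulmxr A) by exact: is_diff_comp dfx h.
split; first by apply: linear_differentiable; exact: mulmxr_continuous.
by rewrite diff_lin//; exact: mulmxr_continuous.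
Qed.

Lemma Cn_on_mulmxr E k (U : set E) m n (A : 'M[R]_(m, n)) (f : E -> 'rV[R]_m) :
  open U -> Cn_on k U f -> Cn_on k U (fun x => f x *m A).
Proof.
move=> oU; apply: (@Cn_on_lin_comp _ _ _ _ _ _ (mulmxr A)) => //.
exact: mulmxr_continuous.
Qed.

Lemma diff_jacobian m n (f : 'rV[R]_m -> 'rV[R]_n) x v :
  'd f x v = v *m 'J f x.
Proof. by rewrite mul_rV_lin1. Qed.

Lemma is_diff_jacobian m n (f : 'rV[R]_m -> 'rV[R]_n) df x v :
  is_diff x f df -> v *m 'J f x = df v.
Proof. by move=> dfx; rewrite -diff_jacobian diff_val. Qed.

Lemma is_diffE E F (f : E -> F) df x v : is_diff x f df -> 'd f x v = df v.
Proof. by move=> dfx; rewrite diff_val. Qed.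

Lemma is_diff_implicit E m (phi : 'rV[R]_m -> 'rV[R]_m)
    (g b : E -> 'rV[R]_m) y :
  {for y, continuous g} -> differentiable phi (g y) ->
  'J phi (g y) \in unitmx ->
  (\forall z \near y, phi (g z) = b z) -> differentiable b y ->
  is_diff y g (fun v => 'd b y v *m invmx ('J phi (g y))).
Proof.
move=> gc dphi uJ phig db; set J := 'J phi (g y).
have dbc : continuous ('d b y) by exact: diff_continuous.
have Jc : continuous (mulmxr (invmx J) : 'rV[R]_m -> _).
  exact: mulmxr_continuous.
(* With [k = g (h + y) - g y] and [J = 'J phi (g y)], both [k *m J] and
   ['d b y h] approximate [b (h + y) - b y]; as [J] is invertible this first
   gives [k = O(h)], after which the error [o(k)] is [o(h)]. *)
have [c c0 cJ] := linear_lipschitz Jc.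
have [d d0 dB] := linear_lipschitz dbc.
pose L : {linear E -> 'rV[R]_m} := mulmxr (invmx J) \o 'd b y.
suff : is_diff y g L by [].
apply: is_diff_eps => [|e e0].
  by move=> v; apply: continuous_comp; [exact: dbc|exact: Jc].
(* Here [c] and [d] are Lipschitz constants of [invmx J] and ['d b y]. From [c * e1 <= 1/2] the
   [|k|] term is absorbed, and with [e2 <= 1] this gives [|k| <= M * |h|]. The other bounds in [e1]
   and [e2] make each of the two errors at most [e / 2 * |h|]. *)
pose M := 2 * c * (d + 1).
have M0 : 0 < M by rewrite !mulr_gt0// addr_gt0.
pose e1 := Num.min (c^-1 / 2) (e / (2 * c * M)).
pose e2 := Num.min 1 (e / (2 * c)).
have c2 : 0 < 2 * c by rewrite mulr_gt0.
have cM : 0 < 2 * c * M by exact: mulr_gt0 c2 M0.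
have e10 : 0 < e1.
  by rewrite lt_min; apply/andP; split; rewrite divr_gt0 ?invr_gt0.
have e20 : 0 < e2 by rewrite lt_min ltr01 divr_gt0// mulr_gt0.
have hy : (h + y) @[h --> (0 : E)] --> y.
  by rewrite -[X in _ --> X]add0r; apply: cvgD; [exact: cvg_id|exact: cvg_cst].
have hk : (g (h + y) - g y) @[h --> (0 : E)] --> (0 : 'rV[R]_m).
  rewrite -(subrr (g y)); apply: cvgB; last exact: cvg_cst.
  exact: cvg_comp hy gc.
have H1 : \forall h \near (0 : E), `|phi (g (h + y)) - phi (g y) -
    (g (h + y) - g y) *m J| <= e1 * `|g (h + y) - g y|.
  have H := hk _ (differentiable_eps dphi e10).
  apply: (@filterS _ (nbhs (0 : E)) _ _ _ _ H) => h /=.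
  by rewrite subrK -diff_jacobian.
have H2 := differentiable_eps db e20.
have H3 := hy _ phig.
have ygy : phi (g y) = b y by exact: nbhs_singleton phig.
near=> h.
have h2 : `|b (h + y) - b y - 'd b y h| <= e2 * `|h| by near: h; exact: H2.
have h3 : phi (g (h + y)) = b (h + y) by near: h; exact: H3.
have h1 : `|phi (g (h + y)) - phi (g y) -
    (g (h + y) - g y) *m J| <= e1 * `|g (h + y) - g y| by near: h; exact: H1.
set k := g (h + y) - g y in h1 *; rewrite /L /=.
rewrite h3 ygy in h1.
have kE : k - 'd b y h *m invmx J =
    ((b (h + y) - b y - 'd b y h) - (b (h + y) - b y - k *m J)) *m invmx J.
  by rewrite opprB [in RHS]addrC [in RHS]addrA subrK mulmxBl mulmxK.
have kb : `|k - 'd b y h *m invmx J| <= c * (e2 * `|h| + e1 * `|k|).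
  rewrite kE (le_trans (cJ _))// ler_pM2l// (le_trans (ler_normB _ _))//.
  exact: lerD.
have e1c : c * e1 <= 1 / 2.
  by rewrite -ler_pdivlMl// mulrC ge_min mul1r mulrC lexx.
have e2c : e2 <= 1 by rewrite ge_min lexx.
have kM : `|k| <= M * `|h|.
  have : `|k| <= c * (e2 * `|h| + e1 * `|k|) + c * (d * `|h|).
    rewrite -[X in `|X| <= _](subrK ('d b y h *m invmx J)).
    rewrite (le_trans (ler_normD _ _))// lerD//.
    by rewrite (le_trans (cJ _))// ler_pM2l.
  have : c * (e2 * `|h|) <= c * `|h|.
    by rewrite ler_pM2l// ler_piMl.
  have : c * e1 * `|k| <= 1 / 2 * `|k| by exact: ler_wpM2r.
  rewrite /M; lra.
rewrite (le_trans kb)//.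
have : c * e1 * `|k| <= e / 2 * `|h|.
  have : c * e1 * `|k| <= c * e1 * (M * `|h|).
    by rewrite ler_wpM2l// ltW// mulr_gt0.
  move=> /le_trans; apply; rewrite mulrA ler_wpM2r//.
  have : e1 <= e / (2 * c * M) by rewrite ge_min lexx orbT.
  rewrite ler_pdivlMr ?mulr_gt0//; lra.
have : c * (e2 * `|h|) <= e / 2 * `|h|.
  rewrite mulrA ler_wpM2r//.
  have : e2 <= e / (2 * c) by rewrite ge_min lexx orbT.
  rewrite ler_pdivlMr ?mulr_gt0//; lra.
by rewrite mulrDr mulrA; lra.
Unshelve. all: by end_near. Qed.

(** Bootstrap on k, starting from continuity: ['d g y v] is ['d b y v] times the inverse Jacobian of
    [phi] at [g y]. If [g] is C^k, so is this expression, by the chain rule for the rows of the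
    Jacobian and by Cramer's rule; hence [g] is C^(k+1). *)
Lemma smooth_on_implicit E m (O : set E) (U : set 'rV[R]_m)
    (phi : 'rV[R]_m -> 'rV[R]_m) (g b : E -> 'rV[R]_m) :
  open O -> (forall y, O y -> U (g y)) ->
  (forall y, O y -> {for y, continuous g}) ->
  smooth_on U phi -> (forall x, U x -> 'J phi x \in unitmx) ->
  (forall y, O y -> phi (g y) = b y) -> smooth_on O b -> smooth_on O g.
Proof.
move=> oO OU gc sphi uJ phig sb; elim=> [//|k IH].
have dphi x : U x -> differentiable phi x by case: (sphi 1%N) => + _; exact.
have db y : O y -> differentiable b y by case: (sb 1%N) => + _; exact.
apply: (@Cn_onS _ _ _ _ _ _ (fun y v => 'd b y v *m invmx ('J phi (g y)))) => //.
  move=> y Oy; apply: is_diff_implicit; rewrite ?phig//.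
  - exact: gc.
  - exact/dphi/OU.
  - exact/uJ/OU.
  - by near=> z; apply: phig; near: z; exact: open_nbhs_nbhs.
  - exact: db.
move=> v; apply: Cn_on_rV => // j; under eq_fun do rewrite mxE.
apply: (@Cn_on_sum _ _ R) => // i; apply: (@Cn_onZ _ _ R) => //.
  by apply: Cn_on_coord => //; exact: Cn_on_diff.
apply: Cn_on_invmx => // [x /OU/uJ //|{}i {}j].
under eq_fun do rewrite mxE.
apply: Cn_on_coord => //.
apply: (@Cn_on_comp _ _ _ _ _ _ U g (fun x => 'd phi x (delta_mx 0 i))) => //.
  exact: smooth_coord_rV.
exact: Cn_on_diff.
Unshelve. all: by end_near. Qed.

(** Mean value theorem for each coordinate of [t |-> f (t *: v + x)], whose derivative is
    ['d f (t *: v + x) v]. Only the direction [v] enters, so this serves both for local constancy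
    and for constancy along a line. *)
Lemma diff0_segment E n (f : E -> 'rV[R]_n) x v :
  (forall t : R, 0 <= t <= 1 -> differentiable f (t *: v + x)) ->
  (forall t : R, 0 <= t <= 1 -> 'd f (t *: v + x) v = 0) ->
  f (v + x) = f x.
Proof.
move=> df df0; apply/rowP => j.
pose h (t : R) := f (t *: v + x) 0 j.
have dh (t : R) : 0 <= t <= 1 -> is_diff t h (fun=> 0).
  move=> t01.
  have d1 : is_diff t (fun t : R => t *: v + x) (fun s => s *: v).
    have H := is_diffD (is_diff_scalel t v) (is_diff_cst x t).
    by apply: is_diff_eq H _; apply/funext => s /=; rewrite addr0.
  have d2 := is_diff_comp d1 (differentiableP (df t t01)).
  have d3 := is_diff_comp d2 (differentiableP (differentiable_coord _ 0 j)).
  apply: is_diff_eq d3 _; apply/funext => s /=.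
  rewrite linearZ/= df0// scaler0.
  by rewrite linear0.
have [||c _] := @MVT_segment R h (fun=> 0) 0 1 ler01.
- move=> t /[!in_itv]/= /andP[t0 t1].
  have dht : is_diff t h (fun=> 0) by apply: dh; rewrite !ltW.
  have dd : derivable h t 1 by apply: diff_derivable; exact: ex_diff.
  apply: DeriveDef => //; rewrite deriveE; last exact: ex_diff.
  by rewrite diff_val.
- apply: continuous_in_subspaceT => t /set_mem/=; rewrite in_itv/= => t01.
  by apply: differentiable_continuous; exact: (@ex_diff _ _ _ _ _ _ _ (dh t t01)).
by rewrite mul0r => /eqP; rewrite subr_eq0 /h scale1r scale0r add0r => /eqP.
Qed.
End Inverse.

(** * Smooth maps between manifolds *)

Program Definition rv_chart (R : realType) n : chart 'rV[R]_n 'rV[R]_n :=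
  @Chart R 'rV[R]_n 'rV[R]_n setT id id _ _ _ _ _.
Next Obligation. by move=> R n; exact: openT. Qed.
Next Obligation. by move=> R n; rewrite image_id; exact: openT. Qed.
Next Obligation. by []. Qed.
Next Obligation. by move=> R n x _; exact: cvg_id. Qed.
Next Obligation. by move=> R n x _; exact: cvg_id. Qed.

Definition rv_atlas (R : realType) n : set (chart 'rV[R]_n 'rV[R]_n) :=
  [set rv_chart R n].

Arguments rv_chart {R} n.
Arguments rv_atlas {R} n _.

Section Manifold.
Context {R : realType}.
Implicit Types (M N P : topologicalType) (E F K : normedModType R).

Lemma chart_imageP M E (c : chart M E) (W : set M) y :
  (c @` (chart_dom c `&` W)) y <->
  (c @` chart_dom c) y /\ W (chart_inv c y).
Proof.
split=> [[x [cx Wx] <-]|[[x cx <-]]].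
  by rewrite chart_funK//; split=> //; exists x.
by rewrite chart_funK// => Wx; exists x.
Qed.

Lemma chart_image_open M E (c : chart M E) (W : set M) :
  open W -> open (c @` (chart_dom c `&` W)).
Proof.
move=> oW; rewrite openE => y /chart_imageP[cy Wy].
have H : \forall z \near y, W (chart_inv c z).
  by apply: (chart_inv_continuous cy); exact: open_nbhs_nbhs.
have H' : \forall z \near y, (c @` chart_dom c) z.
  by apply: open_nbhs_nbhs; split=> //; exact: chart_im_open.
rewrite /interior; near=> z; apply/chart_imageP.
by split; near: z.
Unshelve. all: by end_near. Qed.

Lemma chart_invK M E (c : chart M E) y :
  (c @` chart_dom c) y -> c (chart_inv c y) = y.
Proof. by move=> [x cx <-]; rewrite chart_funK. Qed.

Lemma chart_inv_dom M E (c : chart M E) y :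
  (c @` chart_dom c) y -> chart_dom c (chart_inv c y).
Proof. by move=> [x cx <-]; rewrite chart_funK. Qed.

(** Every clause of [Cn_on] concerns one point at a time, so it can be verified with a set depending
    on the point. For maps of manifolds this allows the intermediate chart to vary. *)
Lemma Cn_on_local E F k (U : set E) (f : E -> F) :
  (forall y, U y -> exists2 V, V y & Cn_on k V f) -> Cn_on k U f.
Proof.
elim: k f => [f H x /H[V Vx]|k IH f H]; first exact.
split=> [x /H[V Vx]|v]; first by case=> d _; exact: d.
by apply: IH => x /H[V Vx cO]; exists V => //; exact: Cn_on_diff.
Qed.

Lemma smooth_on_differentiable E F (U : set E) (f : E -> F) x :
  smooth_on U f -> U x -> differentiable f x.
Proof. by move=> /(_ 1%N)[+ _]; exact. Qed.

Lemma smooth_map_open M N E F (c : chart M E) (d : chart N F) (f : M -> N) :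
  continuous f -> open (c @` (chart_dom c `&` f @^-1` chart_dom d)).
Proof.
move=> /continuousP fc; apply: chart_image_open; apply: fc.
exact: chart_dom_open.
Qed.

Lemma smooth_map_comp M N P E F K (A : set (chart M E)) (B : set (chart N F))
    (C : set (chart P K)) (f : M -> N) (g : N -> P) :
  smooth_coord F -> (forall x : N, exists2 d, B d & chart_dom d x) ->
  smooth_map A B f -> smooth_map B C g -> smooth_map A C (g \o f).
Proof.
move=> bF cov [fc fs] [gc gs].
have gfc : continuous (g \o f).
  by move=> x; apply: continuous_comp; [exact: fc|exact: gc].
split=> // c e Ac Ce k; apply: Cn_on_local => y /chart_imageP[cy ey].
have [d Bd dy] := cov (f (chart_inv c y)).
(* On [O] the representative of [g \o f] in [c] and [e] factors through the intermediate chart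
   [d]. *)
pose O := c @` (chart_dom c `&` f @^-1` chart_dom d) `&`
  c @` (chart_dom c `&` (g \o f) @^-1` chart_dom e).
have oO : open O by apply: openI; exact: smooth_map_open.
exists O; first by split; exact/chart_imageP.
apply: (@eq_Cn_on _ _ _ _ _ (local_rep d e g \o local_rep c d f)) => //.
  move=> z [/chart_imageP[cz dz] /chart_imageP[_ ez]].
  by rewrite /local_rep /= chart_funK.
apply: (Cn_on_comp (V := d @` (chart_dom d `&` g @^-1` chart_dom e))) => //.
- move=> z [/chart_imageP[cz dz] /chart_imageP[_ ez]].
  apply/chart_imageP; rewrite /local_rep /= chart_funK//.
  by split=> //; exists (f (chart_inv c z)).
- exact: gs.
- by apply: Cn_on_sub (fs c d Ac Bd k) => z [].
Qed.

Lemma smooth_map_pair M N P E F K (A : set (chart M E)) (B : set (chart N F))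
    (C : set (chart P K)) (f : M -> N) (g : M -> P) :
  smooth_map A B f -> smooth_map A C g ->
  smooth_map A (prod_atlas B C) (fun x => (f x, g x)).
Proof.
move=> [fc fs] [gc gs].
have fgc : continuous (fun x => (f x, g x)).
  by move=> x; apply: cvg_pair; [exact: fc|exact: gc].
split=> // c _ Ac [d [e [Bd Ce ->]]] k.
have oO := smooth_map_open c (prod_chart d e) fgc.
apply: Cn_on_pair => //.
  by apply: Cn_on_sub (fs c d Ac Bd k) => _ [x [cx [dx ex]] <-]; exists x.
by apply: Cn_on_sub (gs c e Ac Ce k) => _ [x [cx [dx ex]] <-]; exists x.
Qed.

Lemma smooth_map_cst M N E F (A : set (chart M E)) (B : set (chart N F)) a :
  smooth_map A B (fun=> a).
Proof.
have cc : continuous (fun _ : M => a) by move=> x; exact: cvg_cst.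
by split=> // c d _ _ k; apply: Cn_on_cst; exact: smooth_map_open.
Qed.

Lemma smooth_map_id M E (A : set (chart M E)) : smooth_atlas A ->
  smooth_map A A id.
Proof. by move=> [_ cA]; split=> // x; exact: cvg_id. Qed.

(** In charts the projection is the linear map [fst] followed by a transition map of [A]. *)
Lemma smooth_map_fst M N E F (A : set (chart M E)) (B : set (chart N F)) :
  smooth_coord E -> smooth_atlas A -> smooth_map (prod_atlas A B) A fst.
Proof.
move=> bE [_ cA].
have c1 : continuous (@fst M N) by move=> x; exact: cvg_fst.
split=> // _ c' [c [d [Ac Bd ->]]] Ac' k.
apply: (Cn_on_comp (V := c @` (chart_dom c `&` chart_dom c'))
  (f := c' \o chart_inv c) (g := fst)) => //.
- exact: smooth_map_open.
- by move=> _ [x [[cx dx] c'x] <-]; exists x.1.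
- exact: cA.
- apply: (@Cn_on_lin _ _ _ _ _ fst) => [|x]; first exact: smooth_map_open.
  exact: cvg_fst.
Qed.

Lemma smooth_map_snd M N E F (A : set (chart M E)) (B : set (chart N F)) :
  smooth_coord F -> smooth_atlas B -> smooth_map (prod_atlas A B) B snd.
Proof.
move=> bF [_ cB].
have c1 : continuous (@snd M N) by move=> x; exact: cvg_snd.
split=> // _ c' [c [d [Ac Bd ->]]] Bc' k.
apply: (Cn_on_comp (V := d @` (chart_dom d `&` chart_dom c'))
  (f := c' \o chart_inv d) (g := snd)) => //.
- exact: smooth_map_open.
- by move=> _ [x [[cx dx] c'x] <-]; exists x.2.
- exact: cB.
- apply: (@Cn_on_lin _ _ _ _ _ snd) => [|x]; first exact: smooth_map_open.
  exact: cvg_snd.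
Qed.

Lemma smooth_map_to_rv M E (A : set (chart M E)) n (f : M -> 'rV[R]_n) :
  smooth_map A (rv_atlas n) f <->
  continuous f /\
  forall c, A c -> smooth_on (c @` chart_dom c) (f \o chart_inv c).
Proof.
split=> -[fc fs]; split=> //.
  move=> c Ac; have := fs c (rv_chart n) Ac erefl.
  by rewrite preimage_setT setIT.
by move=> c d Ac ->; rewrite preimage_setT setIT; exact: fs.
Qed.

Lemma smooth_map_of_rv M E (A : set (chart M E)) n (f : 'rV[R]_n -> M) :
  smooth_map (rv_atlas n) A f <->
  continuous f /\ forall c, A c -> smooth_on (f @^-1` chart_dom c) (c \o f).
Proof.
split=> -[fc fs]; split=> //.
  by move=> c Ac; have := fs (rv_chart n) c erefl Ac; rewrite image_id setTI.
by move=> c d -> Ad; rewrite image_id setTI; exact: fs.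
Qed.

Lemma rv_atlas_cover n (x : 'rV[R]_n) : exists2 d, rv_atlas n d & chart_dom d x.
Proof. by exists (rv_chart n). Qed.

Lemma smooth_mapD M E (A : set (chart M E)) n (f g : M -> 'rV[R]_n) :
  smooth_map A (rv_atlas n) f -> smooth_map A (rv_atlas n) g ->
  smooth_map A (rv_atlas n) (fun x => f x + g x).
Proof.
move=> /smooth_map_to_rv[fc fs] /smooth_map_to_rv[gc gs].
apply/smooth_map_to_rv; split=> [x|c Ac k].
  by apply: cvgD; [exact: fc|exact: gc].
by apply: Cn_onD; [exact: chart_im_open|exact: fs|exact: gs].
Qed.

(** A translation is [y |-> (x, y)] followed by the multiplication. Translations carry information
    on differentials from one point to all others. *)
Lemma smooth_lmul M n (A : set (chart M 'rV[R]_n)) (l : abelian_law M) x :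
  lie_group A l -> smooth_map A A (lmul l x).
Proof.
move=> [[_ _ sA] sm _].
apply: (smooth_map_comp (f := fun y => (x, y))
   (g := fun p : M * M => lmul l p.1 p.2)) sm.
- by apply: smooth_coord_prod; exact: smooth_coord_rV.
- move=> [y z]; have [cov _] := sA.
  have [c Ac cy] := cov y; have [d Ad dz] := cov z.
  by exists (prod_chart c d) => //; exists c, d.
- by apply: smooth_map_pair; [exact: smooth_map_cst|exact: smooth_map_id].
Qed.

End Manifold.

(** * Closed subgroups and quotients of R^N *)

Section ImmersedSubgroup.
Context (R : realType) (M : topologicalType) (m N : nat)
  (A : set (chart M 'rV[R]_m)) (l : abelian_law M) (j : M -> 'rV[R]_N).
Hypothesis lieM : lie_group A l.
Hypothesis j_smooth : smooth_map A (rv_atlas N) j.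
Hypothesis jM : forall x y, j (lmul l x y) = j x + j y.
Hypothesis j_imm : forall c x, A c -> chart_dom c x ->
  injective ('d (j \o chart_inv c) (c x)).
Hypothesis j_closed : closed (range j).
Hypothesis M_connected : connected [set: M].
Hypothesis j_embedding : forall f : 'rV[R]_N -> M,
  continuous (j \o f) -> continuous f.

Let cov x : exists2 c, A c & chart_dom c x.
Proof. by case: lieM => -[_ _ [+ _] _ _]; exact. Qed.

Let dj c x : A c -> chart_dom c x -> differentiable (j \o chart_inv c) (c x).
Proof.
move=> Ac cx; have [_ /(_ c Ac) H] := (smooth_map_to_rv _ _).1 j_smooth.
by apply: smooth_on_differentiable H _; exists x.
Qed.

Let j1 : j (lone l) = 0.
Proof. by apply: (addrI (j (lone l))); rewrite -jM lmul1 addr0. Qed.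

(** Translation by [k] changes [j] only by the constant [j k], so the chain rule factors one
    Jacobian through the other. By symmetry the row space, which is the image of the differential of
    [j], is the same at all points and in all charts. *)
Lemma jacobian_translate c d x y : A c -> A d -> chart_dom c x ->
  chart_dom d y -> exists B : 'M[R]_m,
    'J (j \o chart_inv c) (c x) = B *m 'J (j \o chart_inv d) (d y).
Proof.
move=> Ac Ad cx dy.
pose k := lmul l y (linv l x).
have kx : lmul l k x = y by rewrite /k -lmulA lmulV lmulC lmul1.
have [kc /(_ c d Ac Ad) ks] := smooth_lmul k lieM.
pose h := local_rep c d (lmul l k).
have hx : h (c x) = d y by rewrite /h /local_rep/= chart_funK// kx.
have oO := smooth_map_open c d kc.
have cxO : (c @` (chart_dom c `&` lmul l k @^-1` chart_dom d)) (c x).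
  by exists x => //; split => //=; rewrite kx.
have dh : is_diff (c x) h ('d h (c x)).
  exact/differentiableP/(smooth_on_differentiable ks).
have djd : is_diff (h (c x)) (j \o chart_inv d) ('d (j \o chart_inv d) (d y)).
  by rewrite hx; exact/differentiableP/dj.
have D := is_diffB (is_diff_comp dh djd) (is_diff_cst (j k) (c x)).
have D' : is_diff (c x) (j \o chart_inv c)
    ('d (j \o chart_inv d) (d y) \o 'd h (c x)).
  apply: is_diff_near (is_diff_eq D _).
    near=> z; have /chart_imageP[cz dz] :
        (c @` (chart_dom c `&` lmul l k @^-1` chart_dom d)) z.
      by near: z; exact: open_nbhs_nbhs.
    rewrite !fctE /h /local_rep /= chart_funK// jM addrC addKr//.
  by rewrite subr0.
exists ('J h (c x)); apply/row_matrixP => i.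
by rewrite !rowE mulmxA (is_diff_jacobian _ D') /= !diff_jacobian.
Unshelve. all: by end_near. Qed.

Let jMn x n : range j (n%:R *: j x).
Proof.
elim: n => [|n [y _ yE]]; first by exists (lone l) => //; rewrite j1 scale0r.
by exists (lmul l x y) => //; rewrite jM yE -natr1 scalerDl scale1r addrC.
Qed.

Lemma range_diff c u : A c -> chart_dom c (lone l) ->
  range j (u *m 'J (j \o chart_inv c) (c (lone l))).
Proof.
move=> Ac c1; rewrite -diff_jacobian.
have dj1 := dj Ac c1.
have := @diff_derivable _ _ _ _ _ u dj1.
rewrite /derivable -/(derive _ _ _) deriveE// => D.
(* Along these times the difference quotient of [j] is [n.+1] times an element of [range j], hence
   lies in [range j]. The shift by one keeps [t n] defined and nonzero, as the punctured filter
   requires. *)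
pose t n : R := n.+1%:R^-1.
have tD : t n @[n --> \oo] --> (0 : R)^'.
  move=> S /= [e e0 H].
  have [n0 _ Hn] : \forall n \near \oo, `|0 - t n| < e.
    near=> n; rewrite sub0r normrN ger0_norm ?invr_ge0// /t.
    by near: n; exact: (near_infty_natSinv_lt (PosNum e0)).
  exists n0 => // n /Hn Hn'; apply: H => //=.
  by rewrite invr_eq0 pnatr_eq0.
have D' := cvg_comp _ _ tD D.
apply: (@closed_cvg _ _ _ _ _ (range j) j_closed _ _ D'); apply: nearW => n /=.
rewrite /t invrK chart_funK// j1 subr0.
exact: jMn.
Unshelve. all: by end_near. Qed.

Lemma range_sub c x : A c -> chart_dom c (lone l) ->
  (j x <= 'J (j \o chart_inv c) (c (lone l)))%MS.
Proof.
move=> Ac c1; set A0 := 'J _ _.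
rewrite submxE; apply/eqP.
(* [f] is [j] modulo the row space of [A0]: multiplication by [cokermx A0] kills exactly that
   space. *)
pose f y := j y *m cokermx A0.
have [jc js] := (smooth_map_to_rv _ _).1 j_smooth.
have fc : continuous f.
  move=> y; apply: (@continuous_comp _ _ _ j (fun v => v *m cokermx A0)).
    exact: jc.
  exact: mulmxr_continuous.
have floc y : \forall z \near y, f z = f y.
  have [d Ad dy] := cov y.
  have : nbhs (d y) (d @` chart_dom d).
    by apply: open_nbhs_nbhs; split; [exact: chart_im_open|exists y].
  move=> /nbhs_ballP[r /= r0 br].
  have H1 : \forall z \near y, ball (d y) r (d z).
    by apply: (chart_fun_continuous dy); exact: nbhsx_ballx.
  have H2 : \forall z \near y, chart_dom d z.
    by apply: open_nbhs_nbhs; split=> //; exact: chart_dom_open.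
  near=> z.
  have dz : chart_dom d z by near: z.
  have bz : ball (d y) r (d z) by near: z.
  (* A ball is convex, so the whole segment from [d y] to [d z] stays in the image of the chart. *)
  have seg (t : R) : 0 <= t <= 1 -> (d @` chart_dom d) (t *: (d z - d y) + d y).
    move=> /andP[t0 t1]; apply: br; move: bz; rewrite -!ball_normE/=.
    rewrite opprD addrCA subrr addr0 normrN normrZ distrC ger0_norm//.
    by apply: le_lt_trans; rewrite ler_piMl.
  pose F := fun v => (j \o chart_inv d) v *m cokermx A0.
  have dF v : (d @` chart_dom d) v -> is_diff v F (fun=> 0).
    move=> [w dw <-].
    have H := is_diff_mulmxr (cokermx A0) (differentiableP (dj Ad dw)).
    apply: is_diff_eq H _; apply/funext => u.
    have [B JB] := jacobian_translate Ad Ac dw c1.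
    by rewrite diff_jacobian JB -!mulmxA mulmx_coker !mulmx0.
  have : F ((d z - d y) + d y) = F (d y).
    apply: diff0_segment => t /seg /dF D; first exact: ex_diff.
    by rewrite (is_diffE _ D).
  by rewrite subrK /F /= !chart_funK.
(* The zero set of [f] contains the identity, is open by local constancy and closed by continuity,
   so connectedness makes it everything. *)
pose Z := [set y | f y = 0].
have ZT : Z = setT.
  apply: M_connected.
  - by exists (lone l); rewrite /Z/= /f j1 mul0mx.
  - exists Z; last by rewrite setTI.
    rewrite openE => y /= Zy; rewrite /interior.
    by apply: filterS (floc y) => z fz; rewrite /Z/= fz.
  - exists Z; last by rewrite setTI.
    have -> : Z = f @^-1` [set 0] by [].
    have /continuous_closedP := fc; apply.
    by apply: accessible_closed_set1; exact: hausdorff_accessible.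
by have : Z x by rewrite ZT.
Unshelve. all: by end_near. Qed.

Lemma smooth_retraction : exists (P : 'M[R]_N) (k : 'rV[R]_N -> M),
  [/\ smooth_map (rv_atlas N) A k,
      forall x, j x *m P = j x & forall v, j (k v) = v *m P].
Proof.
have [c1 Ac1 c11] := cov (lone l).
pose A0 := 'J (j \o chart_inv c1) (c1 (lone l)).
(* This is a projection onto the row space of [A0], which [range_diff] and [range_sub] identify with
   the range of [j]. *)
pose P := pinvmx A0 *m A0.
have kE v : exists h, j h = v *m P.
  have [h _ hE] := range_diff (v *m pinvmx A0) Ac1 c11.
  by exists h; rewrite hE /P -mulmxA.
have [k jk] := choice kE.
have kc : continuous k.
  apply: j_embedding; rewrite (_ : _ \o _ = (fun v => v *m P)).
    exact: mulmxr_continuous.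
  exact/funext.
have imm c x : A c -> chart_dom c x -> row_free ('J (j \o chart_inv c) (c x)).
  move=> Ac cx; apply: inj_row_free => v.
  rewrite -diff_jacobian => v0; apply: (j_imm Ac cx).
  by rewrite v0 linear0.
have A0K : A0 *m pinvmx A0 = 1%:M by apply: mulmxVp; exact: imm.
exists P, k; split=> // [|x]; last first.
  by rewrite mulmxA mulmxKpV// range_sub.
apply/smooth_map_of_rv; split=> // c Ac.
have [_ js] := (smooth_map_to_rv _ _).1 j_smooth.
(* Multiplying by [pinvmx A0] reads off coordinates in the row space of [A0], so that [phi] maps
   between spaces of the same dimension m. Its Jacobian is the factor [B] of
   [jacobian_translate]. *)
apply: (smooth_on_implicit (U := c @` chart_dom c)
  (phi := fun z => (j \o chart_inv c) z *m pinvmx A0)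
  (b := fun v => v *m (P *m pinvmx A0))).
- by have /continuousP := kc; apply; exact: chart_dom_open.
- by move=> v /= cv; exists (k v).
- move=> v /= cv; apply: continuous_comp; first exact: kc.
  exact: chart_fun_continuous.
- move=> i; apply: Cn_on_mulmxr; first exact: chart_im_open.
  exact: js.
- move=> _ [x cx <-].
  have [B JB] := jacobian_translate Ac Ac1 cx c11.
  have JE : 'J (fun z => (j \o chart_inv c) z *m pinvmx A0) (c x) = B.
    have D := is_diff_mulmxr (pinvmx A0) (differentiableP (dj Ac cx)).
    apply/row_matrixP => i; rewrite !rowE (is_diff_jacobian _ D).
    by rewrite diff_jacobian JB -!mulmxA A0K mulmx1.
  (* [v *m B = 0] forces [v] into the kernel of [B *m A0], the Jacobian of [j], which is trivial
     because [j] is an immersion. *)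
  rewrite JE -row_free_unit; apply: inj_row_free => v vB.
  have := imm _ _ Ac cx; rewrite JB -kermx_eq0 => /eqP kr.
  apply/eqP; rewrite -submx0 -kr; apply/sub_kermxP.
  by rewrite mulmxA vB mul0mx.
- by move=> v /= cv; rewrite /= chart_funK// jk -mulmxA.
- move=> i; apply: Cn_on_mulmxr.
    by have /continuousP := kc; apply; exact: chart_dom_open.
  apply: (@Cn_on_lin _ _ _ _ _ idfun) => [|x]; last exact: cvg_id.
  by have /continuousP := kc; apply; exact: chart_dom_open.
Qed.
End ImmersedSubgroup.

(** * Quotients of R^N by the image of a projection: smoothness of the section *)

Section SubmersiveQuotient.
Context (R : realType) (Q : topologicalType) (n N : nat)
  (A : set (chart Q 'rV[R]_n)) (l : abelian_law Q) (p : 'rV[R]_N -> Q)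
  (P : 'M[R]_N) (sigma : Q -> 'rV[R]_N).
Hypothesis lieQ : lie_group A l.
Hypothesis p_smooth : smooth_map (rv_atlas N) A p.
Hypothesis pD : forall x y, p (x + y) = lmul l (p x) (p y).
Hypothesis p_sub : forall d z w, A d -> chart_dom d (p z) ->
  exists v, 'd (d \o p) z v = w.
Hypothesis p_surj : forall a, exists v, p v = a.
Hypothesis P_idem : P *m P = P.
Hypothesis p_ker : forall v, p v = p 0 <-> v *m P = v.
Hypothesis sigma_p : forall v, sigma (p v) = v - v *m P.
Hypothesis sigma_continuous : continuous sigma.

Let cov x : exists2 c, A c & chart_dom c x.
Proof. by case: lieQ => -[_ _ [+ _] _ _]; exact. Qed.

Let p_continuous : continuous p.
Proof. by case: p_smooth. Qed.

Let p_open (d : chart Q 'rV[R]_n) : open (p @^-1` chart_dom d).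
Proof. by have /continuousP := p_continuous; apply; exact: chart_dom_open. Qed.

Let dp d z : A d -> chart_dom d (p z) -> differentiable (d \o p) z.
Proof.
move=> Ad dz; have [_ /(_ d Ad) H] := (smooth_map_of_rv _ _).1 p_smooth.
exact: smooth_on_differentiable H _.
Qed.

Let p0 : p 0 = lone l.
Proof.
have [v pv] := p_surj (lone l).
by rewrite -[LHS](lmul1 l) -pv -pD addr0.
Qed.

Let p_sigma a : p (sigma a) = a.
Proof.
have [v <-] := p_surj a; rewrite sigma_p.
rewrite -[in RHS](subrK (v *m P) v) [in RHS]pD.
have -> : p (v *m P) = p 0 by apply/p_ker; rewrite -mulmxA P_idem.
by rewrite p0 lmulC lmul1.
Qed.

(** Near [z'], [p] is [p] near [z] preceded by a shift of R^N and followed by a translation of [Q].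
    The shift has identity differential, so the kernel of the differential of [p] is the same
    everywhere. *)
Lemma diff_ker_translate d d' z z' v : A d -> A d' ->
  chart_dom d (p z) -> chart_dom d' (p z') ->
  'd (d \o p) z v = 0 -> 'd (d' \o p) z' v = 0.
Proof.
move=> Ad Ad' dz dz' dv.
pose k := p (z' - z).
have kz : lmul l k (p z) = p z' by rewrite /k -pD subrK.
have [kc /(_ d d' Ad Ad') ks] := smooth_lmul k lieQ.
pose h := local_rep d d' (lmul l k).
have dh : is_diff (d (p z)) h ('d h (d (p z))).
  apply/differentiableP/(smooth_on_differentiable ks).
  by exists (p z) => //; split => //=; rewrite kz.
have D1 : is_diff z' (fun y => y - (z' - z)) id.
  have H := is_diffB (is_diff_id z') (is_diff_cst (z' - z) z').
  by apply: is_diff_eq H _; rewrite subr0.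
have z'E : z' - (z' - z) = z by rewrite opprB addrCA subrr addr0.
have D2 : is_diff (z' - (z' - z)) (d \o p) ('d (d \o p) z).
  by rewrite z'E; exact/differentiableP/dp.
have D3 := is_diff_comp D1 D2.
have dh' : is_diff (((d \o p) \o (fun y => y - (z' - z))) z') h
    ('d h (d (p z))).
  by rewrite /= z'E.
have D4 := is_diff_comp D3 dh'.
have D5 : is_diff z' (d' \o p) ('d h (d (p z)) \o ('d (d \o p) z \o id)).
  apply: is_diff_near D4.
  near=> y; rewrite /h /local_rep /= chart_funK.
    by rewrite /k -pD addrC subrK.
  near: y.
  have yc : (y - (z' - z)) @[y --> z'] --> z.
    rewrite -[X in _ --> X]z'E.
    exact: (differentiable_continuous (@ex_diff _ _ _ _ _ _ _ D1)).
  apply: (yc (p @^-1` chart_dom d)).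
  by apply: open_nbhs_nbhs; split.
by rewrite (is_diffE _ D5)/= dv linear0.
Unshelve. all: by end_near. Qed.

(** A direction killed at one point is killed at all points, so [p] is constant on a short segment
    from 0 along [v]. A nonzero multiple of [v] then lies in the kernel of [p], which is a linear
    space by [p_ker]. *)
Lemma diff_ker_sub d z v : A d -> chart_dom d (p z) ->
  'd (d \o p) z v = 0 -> v *m P = v.
Proof.
move=> Ad dz dv.
have [c Ac c0] := cov (p 0).
have tv : (t *: v) @[t --> (0 : R)] --> (0 : 'rV[R]_N).
  by rewrite -[X in _ --> X](scale0r v); exact: scalel_continuous.
have : \forall t \near (0 : R), chart_dom c (p (t *: v)).
  apply: (tv (p @^-1` chart_dom c)).
  by apply: open_nbhs_nbhs; split.
move=> /nbhs_ballP[e /= e0 be].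
have He : 0 < e / 2 by rewrite divr_gt0.
(* Scaling by [e / 2] keeps the segment from 0 to [w] inside the domain of the chart [c] around
   [p 0]. *)
pose w := (e / 2) *: v.
have cw (t : R) : 0 <= t <= 1 -> chart_dom c (p (t *: w + 0)).
  move=> /andP[t0 t1]; rewrite addr0 scalerA; apply: be.
  rewrite -ball_normE/= sub0r normrN ger0_norm ?mulr_ge0// ?ltW//.
  apply: (@le_lt_trans _ _ (e / 2)); first by rewrite ler_piMl// ltW.
  by rewrite ltr_pdivrMr// mulr_natr mulr2n ltrDl.
have H : (c \o p) (w + 0) = (c \o p) 0.
  apply: diff0_segment => t /cw ct; first exact: dp.
  by rewrite linearZ /= (diff_ker_translate Ad Ac dz ct dv) scaler0.
have : p w = p 0.
  have := congr1 (chart_inv c) H; rewrite /= !chart_funK// addr0//.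
  have := cw 1; rewrite scale1r addr0; apply.
  by rewrite ler01 lexx.
move=> /p_ker; rewrite -scalemxAl => /scalerI; apply.
by rewrite gt_eqF.
Qed.

(** The whole line through [v *m P] lies in the kernel of [p], so [p] is constant along it. *)
Lemma diff_ker_sup d v : A d -> chart_dom d (p 0) ->
  'd (d \o p) 0 (v *m P) = 0.
Proof.
move=> Ad d0; set w := v *m P.
have dd : is_diff ((fun t : R => t *: w) 0) (d \o p) ('d (d \o p) 0).
  by rewrite scale0r; exact/differentiableP/dp.
have D := is_diff_comp (is_diff_scalel (0 : R) w) dd.
have E : (d \o p) \o (fun t : R => t *: w) = cst (d (p 0)).
  apply/funext => t /=; congr (d _); apply/p_ker.
  by rewrite -scalemxAl /w -mulmxA P_idem.
have := is_diffE (1 : R) D.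
by rewrite E diff_cst /= scale1r => <-.
Qed.

Lemma smooth_section : smooth_map A (rv_atlas N) sigma.
Proof.
have [d0 Ad0 d00] := cov (p 0).
pose D0 := 'J (d0 \o p) 0.
have fD0 : row_full D0.
  rewrite -sub1mx; apply/row_subP => i; apply/submxP.
  have [v vE] := p_sub (row i 1%:M) Ad0 d00.
  by exists v; rewrite -vE diff_jacobian.
have PD0 : P *m D0 = 0.
  apply/row_matrixP => i; rewrite row_mul row0 -diff_jacobian rowE.
  exact: diff_ker_sup.
(* [B] inverts [D0] with values in the complement of the image of [P]: the two identities below are
   [B *m D0 = 1] and [B *m P = 0]. *)
pose B := pinvmx D0 *m (1%:M - P).
have BD0 : B *m D0 = 1%:M.
  by rewrite -mulmxA mulmxBl PD0 subr0 mul1mx mulVpmx.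
have BP : B *m P = 0 by rewrite -mulmxA mulmxBl mul1mx P_idem subrr mulmx0.
(* The difference [t] of the two sides is killed by both [D0] and [P]. The first makes it a fixed
   vector of [P], the second then makes it zero. So [sigma] can be recovered from its n coordinates
   [sigma a *m D0]. *)
have sB a : sigma a *m D0 *m B = sigma a.
  have sP : sigma a *m P = 0.
    have [v <-] := p_surj a.
    by rewrite sigma_p mulmxBl -mulmxA P_idem subrr.
  apply/subr0_eq; set t := _ - _.
  have tP : t *m P = 0 by rewrite /t mulmxBl sP -(mulmxA _ B) BP mulmx0 subr0.
  rewrite -tP; apply/esym/(diff_ker_sub Ad0 d00).
  by rewrite diff_jacobian /t mulmxBl -(mulmxA _ B) BD0 mulmx1 subrr.
apply/smooth_map_to_rv; split=> // d Ad.
pose U := [set x : 'rV[R]_n | chart_dom d (p (x *m B))].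
have cB : continuous (fun x : 'rV[R]_n => x *m B) by exact: mulmxr_continuous.
have oU : open U.
  by have /continuousP H := cB; exact: H _ (@p_open d).
have oD := chart_im_open d.
suff gs : smooth_on (d @` chart_dom d) (fun y => sigma (chart_inv d y) *m D0).
  move=> k; apply: eq_Cn_on oD _ (Cn_on_mulmxr B oD (gs k)) => y _.
  exact: sB.
(* [phi] is [p] restricted to the complement, read in the coordinates given by [B]. As [sigma] is a
   section of [p], the coordinates [h] of [sigma] solve [phi \o h = id]. *)
pose phi (x : 'rV[R]_n) := (d \o p) (x *m B).
pose h y := sigma (chart_inv d y) *m D0.
suff : smooth_on (d @` chart_dom d) h by [].
apply: (@smooth_on_implicit _ _ _ _ U phi h id).
- exact: oD.
- by move=> y dy; rewrite /U/= sB p_sigma; exact: chart_inv_dom.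
- move=> y dy; apply: (@continuous_comp _ _ _ (sigma \o chart_inv d)
    (fun v => v *m D0)); last exact: mulmxr_continuous.
  apply: continuous_comp; first exact: chart_inv_continuous.
  exact: sigma_continuous.
- move=> k; apply: (@Cn_on_comp _ _ _ _ _ _ (p @^-1` chart_dom d)
    (fun x => x *m B) (d \o p)).
  + exact: smooth_coord_rV.
  + exact: oU.
  + by [].
  + by have [_ /(_ d Ad)] := (smooth_map_of_rv _ _).1 p_smooth.
  + apply: Cn_on_mulmxr => //.
    by apply: (@Cn_on_lin _ _ _ _ _ idfun) => // x; exact: cvg_id.
(* If the differential of [p] kills [v *m B] at this point, it does so at 0, and then
   [v = v *m B *m D0 = 0]. *)
- move=> x Ux; rewrite -row_free_unit; apply: inj_row_free => v.
  have D1 : is_diff x (fun y : 'rV[R]_n => y *m B) (fun v => v *m B).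
    exact: is_diff_mulmxr (is_diff_id x).
  have D2 := is_diff_comp D1 (differentiableP (dp Ad Ux)).
  rewrite (is_diff_jacobian _ D2)/= => vB.
  have := diff_ker_translate Ad Ad0 Ux d00 vB.
  by rewrite diff_jacobian -mulmxA BD0 mulmx1.
- by move=> y dy; rewrite /phi /h /= sB p_sigma chart_invK.
- move=> k; apply: (@Cn_on_lin _ _ _ _ _ idfun) => // x; exact: cvg_id.
Qed.
End SubmersiveQuotient.

(** * Log-Euclidean groups *)

Section LogEuclidean.
Context (R : realType) (g : vectType R) (G : log_euclidean g).
Local Notation N := (dim g).

Definition le_coord (x : G) : 'rV[R]_N := v2r (le_log G x).
Definition le_ofcoord (v : 'rV[R]_N) : G := le_exp G (r2v v).

Lemma le_coordK : cancel le_coord le_ofcoord.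
Proof. by move=> x; rewrite /le_ofcoord /le_coord v2rK le_logK. Qed.

Lemma le_ofcoordK : cancel le_ofcoord le_coord.
Proof. by move=> x; rewrite /le_ofcoord /le_coord le_expK r2vK. Qed.

Lemma le_coord_smooth : smooth_map (le_atlas G) (rv_atlas N) le_coord.
Proof.
have [lc ls] := @le_log_smooth R g G.
apply/smooth_map_to_rv; split.
  move=> x; apply: (@continuous_comp _ _ _ (le_log G : G -> vect_top g)
    (v2r : vect_top g -> 'rV[R]_N)); first exact: lc.
  exact: initial_continuous.
move=> c Ac; have := ls c (vect_chart g) Ac erefl.
by rewrite preimage_setT setIT.
Qed.

Lemma le_ofcoord_smooth : smooth_map (rv_atlas N) (le_atlas G) le_ofcoord.
Proof.
have [lc ls] := @le_exp_smooth R g G.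
apply/smooth_map_of_rv; split.
  move=> x; apply: (@continuous_comp _ _ _ (r2v : 'rV[R]_N -> vect_top g)
    (le_exp G : vect_top g -> G)); last exact: lc.
  apply: (chart_inv_continuous (c := vect_chart g)).
  by exists (r2v x); rewrite //= r2vK.
move=> c Ac; have := ls (vect_chart g) c erefl Ac.
rewrite (_ : _ @` _ = le_ofcoord @^-1` chart_dom c)//.
apply/seteqP; split=> [_ [x [_ xc] <-]|v vc].
  by rewrite /le_ofcoord/= v2rK.
by exists (r2v v); [split|rewrite /= r2vK].
Qed.

Lemma le_coordM x y :
  le_coord (lmul (le_law G) x y) = le_coord x + le_coord y.
Proof. by rewrite /le_coord /= le_expK linearD. Qed.

Lemma le_ofcoordD v w :
  le_ofcoord (v + w) = lmul (le_law G) (le_ofcoord v) (le_ofcoord w).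
Proof. by apply: (can_inj le_coordK); rewrite le_coordM !le_ofcoordK. Qed.

Lemma le_cover (x : G) : exists2 c, le_atlas G c & chart_dom c x.
Proof. by have [_ _ [cov _]] := le_manifold G; exact: cov. Qed.

Lemma le_coordV x : le_coord (linv (le_law G) x) = - le_coord x.
Proof. by rewrite /le_coord /= le_expK linearN. Qed.

End LogEuclidean.

(** A clopen set of the subtype is the trace of an open set of [T] and also of a closed one, so its
    image is relatively clopen in [A]. *)
Lemma connected_set_type (T : topologicalType) (A : set T) :
  connected A -> connected [set: set_type A].
Proof.
move=> cA B [x Bx] [C oC BC] [D cD BD].
rewrite setTI in BC; rewrite setTI in BD.
have [C' oC' C'E] : exists2 C', open C' & set_val @^-1` C' = C.
  by case: oC => C' oC' <-; exists C'.
have [D' oD' D'E] : exists2 D', open D' & set_val @^-1` D' = ~` D.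
  by case: (closed_openC cD) => D' oD' <-; exists D'.
have mC (y : set_type A) : B y <-> C' (set_val y) by rewrite BC -C'E.
have mD (y : set_type A) : B y <-> ~ D' (set_val y).
  rewrite BD -(setCK D) -D'E; split; exact.
have E : (set_val : set_type A -> T) @` B = A.
  apply: cA.
  - by exists (set_val x), x.
  - exists C' => //; apply/seteqP; split=> [_ [y By <-]|y [Ay C'y]].
      by split; [exact: set_valP|exact/mC].
    by exists (SigSub (mem_set Ay)) => //; exact/mC.
  - exists (~` D'); first exact: open_closedC.
    apply/seteqP; split=> [_ [y By <-]|y [Ay D'y]].
      by split; [exact: set_valP|exact/mD].
    by exists (SigSub (mem_set Ay)) => //; exact/mD.
apply/seteqP; split=> // y _.
have : (set_val @` B) (set_val y) by rewrite E; exact: set_valP.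
by move=> [z Bz /val_inj <-].
Qed.

Lemma continuous_to_set_type (S T : topologicalType) (A : set T)
    (f : S -> set_type A) : continuous (set_val \o f) -> continuous f.
Proof.
move=> /continuousP H; apply/continuousP => _ [U oU <-].
exact: H.
Qed.

Theorem theorem4p6 (R : realType) (g : vectType R) (G : log_euclidean g)
    (H : subgroup (le_law G)) (m n : nat)
    (AH : set (chart (set_type H) 'rV[R]_m))
    (AQ : set (chart (quot_top H) 'rV[R]_n)) :
  closed (H : set G) ->
  connected (H : set G) ->
  embedded_lie_subgroup (le_atlas G) AH ->
  quotient_lie_group (le_atlas G) AQ ->
  trivial_principal_bundle (le_atlas G) AQ AH (sub_law H)
    (quot_pi H) (right_mul (H := H)).
Proof.
move=> clH cnH [lieH [iota_smooth iota_imm]] [lieQ [pi_smooth pi_sub]].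
(* [j] and [p] are the inclusion of [H] and the quotient map read in logarithmic coordinates, where
   they become additive. *)
pose j (h : set_type H) := le_coord (set_val h).
pose p (v : 'rV[R]_(dim g)) := quot_pi H (le_ofcoord G v).
have j_smooth : smooth_map AH (rv_atlas (dim g)) j.
  apply: (smooth_map_comp (@smooth_coord_rV R _) (@le_cover _ _ G) iota_smooth).
  exact: le_coord_smooth.
have p_smooth : smooth_map (rv_atlas (dim g)) AQ p.
  apply: smooth_map_comp pi_smooth => //.
  - exact: smooth_coord_rV.
  - exact: le_cover.
  - exact: le_ofcoord_smooth.
have jM x y : j (lmul (sub_law H) x y) = j x + j y by exact: le_coordM.
have pD x y : p (x + y) = lmul (quot_law H) (p x) (p y).
  by rewrite /p le_ofcoordD /= quotl_mulE.
have j_inj : injective j.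
  by move=> x y /(can_inj (@le_coordK _ _ G))/val_inj.
have ofcoord_j h : le_ofcoord G (j h) = set_val h by rewrite /j le_coordK.
have ofcoord_H v : (H : set G) (le_ofcoord G v) <-> range j v.
  split=> [Hv|[h _ <-]]; last by rewrite ofcoord_j; exact: set_valP.
  by exists (SigSub (mem_set Hv)) => //; rewrite /j /= le_ofcoordK.
have j_closed : closed (range j).
  rewrite (_ : range j = le_ofcoord G @^-1` H).
    have [/continuous_closedP cc _] := le_ofcoord_smooth G.
    exact: cc.
  by apply/seteqP; split=> v /ofcoord_H.
have H_connected := connected_set_type cnH.
have j_embedding (f : 'rV[R]_(dim g) -> set_type H) :
    continuous (j \o f) -> continuous f.
  move=> jf; apply: continuous_to_set_type.
  have -> : set_val \o f = le_ofcoord G \o (j \o f).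
    by apply/funext => v; rewrite /= ofcoord_j.
  move=> v; apply: continuous_comp; first exact: jf.
  by case: (le_ofcoord_smooth G) => + _; exact.
have j_imm c x : AH c -> chart_dom c x ->
    injective ('d (j \o chart_inv c) (c x)).
  move=> Ac cx; have [d Ad dx] := le_cover (set_val x : G).
  have dj : is_diff (c x) (j \o chart_inv c) ('d (j \o chart_inv c) (c x)).
    apply/differentiableP.
    have [_ /(_ c Ac) sj] := (smooth_map_to_rv _ _).1 j_smooth.
    by apply: smooth_on_differentiable sj _; exists x.
  have de : is_diff ((j \o chart_inv c) (c x)) (d \o le_ofcoord G)
      ('d (d \o le_ofcoord G) (j x)).
    rewrite /= chart_funK//; apply/differentiableP.
    have [_ /(_ d Ad) se] := (smooth_map_of_rv _ _).1 (le_ofcoord_smooth G).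
    by apply: smooth_on_differentiable se _; rewrite /= ofcoord_j.
  (* The inclusion in charts factors through [j], so injectivity of its differential passes to the
     first factor. *)
  have repE : local_rep c d (set_val : set_type H -> G) =
      (d \o le_ofcoord G) \o (j \o chart_inv c).
    by apply/funext => y; rewrite /local_rep /= ofcoord_j.
  move=> v w vw; apply: (iota_imm c d x Ac Ad cx dx).
  have D := is_diff_comp dj de.
  by rewrite repE !(is_diffE _ D) /= vw.
have p_sub d z w : AQ d -> chart_dom d (p z) ->
    exists v, 'd (d \o p) z v = w.
  move=> Ad dz; pose x := le_ofcoord G z.
  have [c Ac cx] := le_cover x.
  have [u uw] := pi_sub c d x Ac Ad cx dz w.
  have dl : is_diff (c x) (le_coord (G := G) \o chart_inv c)
      ('d (le_coord (G := G) \o chart_inv c) (c x)).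
    apply/differentiableP.
    have [_ /(_ c Ac) sl] := (smooth_map_to_rv _ _).1 (le_coord_smooth G).
    by apply: smooth_on_differentiable sl _; exists x.
  have lx : (le_coord (G := G) \o chart_inv c) (c x) = z.
    by rewrite [LHS]/= (chart_funK cx) /x le_ofcoordK.
  have dp : is_diff ((le_coord (G := G) \o chart_inv c) (c x)) (d \o p)
      ('d (d \o p) z).
    rewrite lx; apply/differentiableP.
    have [_ /(_ d Ad) sp] := (smooth_map_of_rv _ _).1 p_smooth.
    exact: smooth_on_differentiable sp _.
  have repE : local_rep c d (quot_pi H) =
      (d \o p) \o (le_coord (G := G) \o chart_inv c).
    by apply/funext => y; rewrite /local_rep /p /= le_coordK.
  have D := is_diff_comp dl dp.
  (* The vector [u] is a preimage of [w] in a chart of [G]; the differential of the logarithmic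
     coordinates carries it to R^N. *)
  exists ('d (le_coord (G := G) \o chart_inv c) (c x) u).
  by rewrite -uw repE (is_diffE _ D).
have [P [k [k_smooth jP jk]]] :=
  smooth_retraction lieH j_smooth jM j_imm j_closed H_connected j_embedding.
(* Row i of [P] is the value of [j] at [k (delta_mx 0 i)], and [P] fixes the values of [j]. *)
have PP : P *m P = P.
  apply/row_matrixP => i; rewrite row_mul rowE.
  by rewrite -(jk (delta_mx 0 i)) jP.
have p_eq v w : p v = p w <-> (w - v) *m P = w - v.
  have E : lmul (le_law G) (linv (le_law G) (le_ofcoord G v)) (le_ofcoord G w) =
      le_ofcoord G (w - v).
    apply: (can_inj (@le_coordK _ _ G)).
    by rewrite le_coordM le_coordV !le_ofcoordK addrC.
  split=> [/quot_piP|vP].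
    by rewrite E => /ofcoord_H[h _ <-].
  apply/quot_piP; rewrite E; apply/ofcoord_H.
  by exists (k (w - v)); rewrite // jk.
have p_ker v : p v = p 0 <-> v *m P = v.
  by rewrite -{2 3}(subr0 v) -p_eq; split=> ->.
have p_surj a : exists v, p v = a.
  by exists (le_coord (repr a)); rewrite /p le_coordK; exact: reprK.
(* Two representatives of a coset differ by a vector fixed by [P], so removing the [P] component
   gives a result independent of [repr]; this is [sigma_p]. *)
pose sigma (a : quot_top H) : 'rV[R]_(dim g) :=
  let v := le_coord (repr a) in v - v *m P.
have sigma_p v : sigma (p v) = v - v *m P.
  rewrite /sigma; set u := le_coord _.
  have : p u = p v by rewrite /p le_coordK; exact: reprK.
  move=> /p_eq; rewrite mulmxBl => /eqP; rewrite subr_eq => /eqP ->.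
  by rewrite opprD addrA opprB [v + _]addrC subrK.
(* By the universal property of the quotient topology it suffices that [sigma] after the projection
   is continuous, and that composite is linear in logarithmic coordinates. *)
have sigma_c : continuous sigma.
  apply/quotient_continuous.
  have -> : sigma \o \pi_(quot_top H)%qT =
      (fun v => v *m (1%:M - P)) \o le_coord (G := G).
    apply/funext => x; rewrite /= mulmxBr mulmx1 -sigma_p /p le_coordK//.
  have [lc _] := le_coord_smooth G.
  move=> x; apply: (@continuous_comp _ _ _ (le_coord (G := G))
    (fun v => v *m (1%:M - P))); [exact: lc|exact: mulmxr_continuous].
have sigma_smooth := smooth_section lieQ p_smooth pD p_sub p_surj PP p_ker
  sigma_p sigma_c.
have sigmaP a : sigma a *m P = 0.
  by have [v <-] := p_surj a; rewrite sigma_p mulmxBl -mulmxA PP subrr.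
have pi_sigma a : p (sigma a) = a.
  have [v <-] := p_surj a; rewrite sigma_p; apply/p_eq.
  by rewrite opprB addrCA subrr addr0 -mulmxA PP.
exists (fun x => (quot_pi H x, k (le_coord x))).
split=> //.
- exists (fun y => le_ofcoord G (sigma y.1 + j y.2)); split.
  + move=> x /=; rewrite jk -[in quot_pi H x](le_coordK x) -/(p _) sigma_p subrK.
    exact: le_coordK.
  + move=> [a h] /=; congr pair; last first.
      by apply: j_inj; rewrite jk le_ofcoordK mulmxDl sigmaP add0r jP.
    rewrite -[RHS]pi_sigma; apply/p_eq.
    by rewrite opprD addrA subrr add0r mulNmx jP.
  + apply: smooth_map_pair => //.
    apply: smooth_map_comp k_smooth.
    * exact: smooth_coord_rV.
    * exact: rv_atlas_cover.
    * exact: le_coord_smooth.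
  + apply: (@smooth_map_comp _ _ _ _ _ _ _ _ (rv_atlas (dim g)) _
      (fun y => sigma y.1 + j y.2) (le_ofcoord G)).
    * exact: smooth_coord_rV.
    * exact: rv_atlas_cover.
    * apply: smooth_mapD.
        apply: (smooth_map_comp (g := sigma)) sigma_smooth.
        - exact: smooth_coord_rV.
        - by case: lieQ => -[_ _ []].
        - by apply: smooth_map_fst; [exact: smooth_coord_rV|case: lieQ => -[]].
      apply: (smooth_map_comp (g := j)) j_smooth.
      - exact: smooth_coord_rV.
      - by case: lieH => -[_ _ []].
      - by apply: smooth_map_snd; [exact: smooth_coord_rV|case: lieH => -[]].
    * exact: le_ofcoord_smooth.
(* Equivariance: multiplying by [s] preserves the coset, and in the second component [P] is additive
   and fixes [j s]. *)
- move=> x s /=; congr pair.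
    apply/esym/quot_piP; rewrite /right_mul lmulA lmulV lmul1.
    exact: set_valP.
  apply: j_inj; rewrite jM !jk le_coordM mulmxDl; congr (_ + _).
  exact: jP.
Qed.
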